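(* Let $n$ be a positive integer and $r>0$, and let $\mathfrak{B}_r$ be the open ball of radius $r$ centered at the origin of $\mathbb{R}^n$. Given $\varepsilon>0$ there are $\delta_1=\delta_1(\varepsilon)>0$ and $\delta_2=\delta_2(\varepsilon)>0$ small enough such that the following holds: if $\Omega\subset\mathbb{R}^n$ is a bounded domain satisfying $\mathscr{L}^n(\Omega)=\mathscr{L}^n(\mathfrak{B}_r)$, $$|\lambda_{1,\infty}^D(\Omega)-\lambda_{1,\infty}^D(\mathfrak{B}_r)|<\delta_1\quad\text{and}\quad|\lambda_{1,\infty}^N(\Omega)-\lambda_{1,\infty}^N(\mathfrak{B}_r)|<\delta_2,$$ and $u$ is a normalized $\infty$-ground state in $\Omega$, then $$|u(x)-v_\infty(x)|<\varepsilon\quad\text{for all }x\in\Omega\cap\mathfrak{B}_r,$$ where $v_\infty(x)=1-\frac{|x|}{r}$ is the normalized $\infty$-ground state in $\mathfrak{B}_r$.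
   Context: $\mathscr{L}^n$ is Lebesgue measure on $\mathbb{R}^n$; a domain is a connected open set. For a bounded domain $\Omega$, the first Dirichlet $\infty$-eigenvalue is $$\lambda_{1,\infty}^D(\Omega)=\inf\{\|\nabla u\|_{L^\infty(\Omega)}: u\in W^{1,\infty}_0(\Omega),\ \|u\|_{L^\infty(\Omega)}=1\}=\Big(\max_{x\in\Omega}\mathrm{dist}(x,\partial\Omega)\Big)^{-1},$$ i.e. the reciprocal of the radius of the largest ball inscribed in $\Omega$ (this formula may be taken as the definition). The first nontrivial Neumann $\infty$-eigenvalue is $$\lambda_{1,\infty}^N(\Omega)=\frac{2}{\mathrm{diam}(\Omega)},$$ where $\mathrm{diam}(\Omega)=\max_{x,y\in\overline\Omega}d_\Omega(x,y)$ is the intrinsic diameter and $d_\Omega(x,y)$ is the geodesic distance, the infimum of the lengths of Lipschitz curves in $\overline\Omega$ connecting $x$ and $y$ (this formula is taken as the definition). In particular $\lambda_{1,\infty}^D(\mathfrak{B}_r)=\lambda_{1,\infty}^N(\mathfrak{B}_r)=1/r$. An $\infty$-ground state in $\Omega$ is a nontrivial viscosity solution $u$ of $$\min\big\{-\Delta_\infty u,\ |\nabla u|-\lambda_{1,\infty}^D(\Omega)\,u\big\}=0\ \text{ in }\Omega,\qquad u=0\ \text{ on }\partial\Omega,$$ where $\Delta_\infty u(x)=\nabla u(x)^T D^2u(x)\,\nabla u(x)$ is the $\infty$-Laplace operator; it is normalized if $\|u\|_{L^\infty(\Omega)}=1$. It need not be unique for a general $\Omega$.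
   Formalization: As the hypotheses are translation invariant, the claim fails for a translated ball; it is proved after moving any center a of a largest inscribed ball of Ω to the origin: |u(a+x) − v_∞(x)| < ε for all x in 𝔅_r with a+x in Ω. *)

(* Defs.v *)
From HB Require Import structures.
From mathcomp Require Import all_boot all_order all_algebra.
From mathcomp Require Import all_classical all_reals all_analysis.

Set Implicit Arguments.
Unset Strict Implicit.
Unset Printing Implicit Defensive.

Import Order.TTheory GRing.Theory Num.Theory.
Import numFieldNormedType.Exports.

Local Open Scope classical_set_scope.
Local Open Scope ring_scope.

(* R^n is 'rV[R]_n.  The library norm `|x| on 'rV[R]_n is the sup norm: it is
   used below only through topology, boundedness and the Lipschitz property,
   which do not depend on the norm; every metric quantity uses enorm. *)
Definition enorm (R : realType) (n : nat) (x : 'rV[R]_n) : R :=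
  Num.sqrt (\sum_(i < n) x ord0 i ^+ 2).

Definition eball (R : realType) (n : nat) (a : 'rV[R]_n) (r : R) :
  set 'rV[R]_n := [set x | enorm (x - a) < r].

Definition bounded_domain (R : realType) (n : nat) (Omega : set 'rV[R]_n) :
  Prop := [/\ open Omega, connected Omega & bounded_set Omega].

Definition boundary (R : realType) (n : nat) (A : set 'rV[R]_n) :
  set 'rV[R]_n := closure A `\` interior A.

Definition box (R : realType) (n : nat) (a b : 'rV[R]_n) : set 'rV[R]_n :=
  [set x | forall i, a ord0 i <= x ord0 i <= b ord0 i].

Definition box_volume (R : realType) (n : nat) (a b : 'rV[R]_n) : R :=
  \prod_(i < n) Num.max 0 (b ord0 i - a ord0 i).

(* n-dimensional Lebesgue (outer) measure, by countable coverings with boxes;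
   on Lebesgue measurable sets, in particular open ones, it is the Lebesgue
   measure. *)
Definition lebesgue_n (R : realType) (n : nat) (A : set 'rV[R]_n) : \bar R :=
  ereal_inf [set (\sum_(0 <= k <oo) (box_volume (c k).1 (c k).2)%:E)%E |
    c in [set c : nat -> 'rV[R]_n * 'rV[R]_n |
            A `<=` \bigcup_k box (c k).1 (c k).2]].

(* Essential supremum of |u| over Omega. *)
Definition Linfty_norm (R : realType) (n : nat) (Omega : set 'rV[R]_n)
    (u : 'rV[R]_n -> R) : \bar R :=
  ereal_inf [set M%:E | M in [set M : R |
    0 <= M /\ lebesgue_n [set x | Omega x /\ M < `|u x|] = 0%E]].

Definition dist_set (R : realType) (n : nat) (x : 'rV[R]_n)
    (A : set 'rV[R]_n) : R := inf [set enorm (x - y) | y in A].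

Definition inradius (R : realType) (n : nat) (Omega : set 'rV[R]_n) : R :=
  sup [set dist_set x (boundary Omega) | x in Omega].

Definition lambdaD (R : realType) (n : nat) (Omega : set 'rV[R]_n) : R :=
  (inradius Omega)^-1.

(* Centre of a largest inscribed ball.  Volume and both eigenvalues are
   invariant under translations of Omega, whereas a pointwise comparison of u
   with the function v_infty, centred at 0, is not; an incenter is moved to the
   origin before comparing. *)
Definition incenter (R : realType) (n : nat) (Omega : set 'rV[R]_n)
    (a : 'rV[R]_n) : Prop :=
  Omega a /\ dist_set a (boundary Omega) = inradius Omega.

(* Same shape as [variation] in numfun, for the Euclidean norm. *)
Definition polygonal_length (R : realType) (n : nat) (g : R -> 'rV[R]_n)
    (s : seq R) : R :=
  let F := g \o nth 1 (0 :: s) in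
  \sum_(0 <= k < size s) enorm (F k.+1 - F k).

Definition curve_length (R : realType) (n : nat) (g : R -> 'rV[R]_n) : \bar R :=
  ereal_sup [set (polygonal_length g s)%:E | s in itv_partition 0 1].

Definition lipschitz_curve_in (R : realType) (n : nat) (A : set 'rV[R]_n)
    (x y : 'rV[R]_n) (g : R -> 'rV[R]_n) : Prop :=
  [/\ [lipschitz g t | t in `[0, 1]], g 0 = x, g 1 = y &
      forall t, 0 <= t <= 1 -> A (g t)].

(* +oo when no Lipschitz curve in the closure of Omega joins x to y. *)
Definition geodesic_dist (R : realType) (n : nat) (Omega : set 'rV[R]_n)
    (x y : 'rV[R]_n) : \bar R :=
  ereal_inf [set curve_length g | g in lipschitz_curve_in (closure Omega) x y].

Definition intrinsic_diam (R : realType) (n : nat) (Omega : set 'rV[R]_n) :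
    \bar R :=
  ereal_sup [set geodesic_dist Omega p.1 p.2 |
              p in closure Omega `*` closure Omega].

(* If the intrinsic diameter is +oo then fine maps it to 0, and the value is
   2 / 0 = 0, which is the convention 2 / +oo = 0. *)
Definition lambdaN (R : realType) (n : nat) (Omega : set 'rV[R]_n) : R :=
  2 / fine (intrinsic_diam Omega).

Definition partial (R : realType) (n : nat) (i : 'I_n) (f : 'rV[R]_n -> R) :
  'rV[R]_n -> R := fun x => 'D_(delta_mx ord0 i) f x.

Definition grad (R : realType) (n : nat) (f : 'rV[R]_n -> R) (x : 'rV[R]_n) :
  'rV[R]_n := \row_(i < n) partial i f x.

Definition hess (R : realType) (n : nat) (f : 'rV[R]_n -> R) (x : 'rV[R]_n) :
  'M[R]_n := \matrix_(i < n, j < n) partial i (partial j f) x.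

Definition infty_laplacian (R : realType) (n : nat) (f : 'rV[R]_n -> R)
    (x : 'rV[R]_n) : R :=
  (grad f x *m hess f x *m (grad f x)^T) ord0 ord0.

(* f is C^2 in a neighbourhood of x: its partial derivatives of order at most
   two exist and are continuous there. *)
Definition C2_near (R : realType) (n : nat) (f : 'rV[R]_n -> R)
    (x : 'rV[R]_n) : Prop :=
  \forall y \near x, forall i : 'I_n,
    [/\ derivable f y (delta_mx ord0 i),
        {for y, continuous (partial i f)} &
        forall j : 'I_n,
          derivable (partial i f) y (delta_mx ord0 j) /\
          {for y, continuous (partial j (partial i f))}].

Definition ground_state_op (R : realType) (n : nat) (Lambda : R)
    (phi : 'rV[R]_n -> R) (x : 'rV[R]_n) (s : R) : R :=
  Num.min (- infty_laplacian phi x) (enorm (grad phi x) - Lambda * s).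

Definition viscosity_supersolution (R : realType) (n : nat)
    (Omega : set 'rV[R]_n) (Lambda : R) (u : 'rV[R]_n -> R) : Prop :=
  forall (x0 : 'rV[R]_n) (phi : 'rV[R]_n -> R),
    Omega x0 -> C2_near phi x0 ->
    (\forall x \near x0, u x0 - phi x0 <= u x - phi x) ->
    0 <= ground_state_op Lambda phi x0 (u x0).

Definition viscosity_subsolution (R : realType) (n : nat)
    (Omega : set 'rV[R]_n) (Lambda : R) (u : 'rV[R]_n -> R) : Prop :=
  forall (x0 : 'rV[R]_n) (phi : 'rV[R]_n -> R),
    Omega x0 -> C2_near phi x0 ->
    (\forall x \near x0, u x - phi x <= u x0 - phi x0) ->
    ground_state_op Lambda phi x0 (u x0) <= 0.

(* Only the values of u on the closure of Omega matter. *)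
Definition infty_ground_state (R : realType) (n : nat) (Omega : set 'rV[R]_n)
    (u : 'rV[R]_n -> R) : Prop :=
  [/\ {within closure Omega, continuous u},
      viscosity_supersolution Omega (lambdaD Omega) u,
      viscosity_subsolution Omega (lambdaD Omega) u,
      (forall x, boundary Omega x -> u x = 0) &
      exists2 x, Omega x & u x != 0].

Definition normalized_infty_ground_state (R : realType) (n : nat)
    (Omega : set 'rV[R]_n) (u : 'rV[R]_n -> R) : Prop :=
  infty_ground_state Omega u /\ Linfty_norm Omega u = 1%E.

Definition v_infty (R : realType) (n : nat) (r : R) (x : 'rV[R]_n) : R :=
  1 - enorm x / r.

(* Main.v *)
Require Import Defs.
From mathcomp Require Import all_boot all_order all_algebra.
From mathcomp Require Import all_classical all_reals all_analysis.
From mathcomp Require Import measurable_realfun.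
From mathcomp Require Import ring lra.
Import Order.TTheory GRing.Theory Num.Theory.
Import numFieldNormedType.Exports.
Local Open Scope classical_set_scope.
Local Open Scope ring_scope.

(** Let [R1] be the inradius of [Omega], [D] its intrinsic diameter and [a] an
incenter. Closeness of the eigenvalues to [1 / r] means that [R1] is close to
[r] and [D] to [2 r].

Geometry: [Omega] contains the ball of radius [R1] about [a]
([eball_sub_domain]). A point of [Omega] at distance [t] from [a] lies at
distance almost [t + R1] from the points of this ball on the opposite side of
[a], and the intrinsic distance dominates the Euclidean one, so [t <= D - R1]
([domain_sub_cball]). Thus [Omega] is squeezed between two concentric balls
whose radii are both close to [r].

Analysis: with [Lambda = 1 / R1], the ground state is squeezed between two
cones, by comparison with cones bent by a small quadratic term so as to become
strict super- or subsolutions of the infinity-Laplace equation. Since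
[u <= 1], the cone [Lambda * (D - R1 - |y - a|)] lies above [u]
([subsolution_le_cone]): where the slope exceeds [Lambda * u], a subsolution is
infinity-subharmonic. By normalization [u] takes the value [1] at some [z]
([exists_peak]), and the upper cone forces [|z - a| <= D - 2 R1], which is
small. The cone with vertex [z] and height [1] vanishing on the sphere of radius
[d = R1 - |z - a|] about [z] lies below [u], because [u] is
infinity-superharmonic and nonnegative ([supersolution_ge0],
[supersolution_ge_cone]). Both cones are close to [1 - |y - a| / r].

Normalization bounds [u] only almost everywhere; the pointwise bound uses that
nonempty open sets have positive outer measure ([lebesgue_n_open_neq0]). This
holds because countably many boxes covering a box have at least its volume
([weighted_box_cover]). *)

(** * The Euclidean norm *)

Lemma enorm_ge0 {R : realType} {n : nat} (x : 'rV[R]_n) : 0 <= enorm x.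
Proof. exact: sqrtr_ge0. Qed.

Lemma sumsq_ge0 {R : realType} {n : nat} (x : 'rV[R]_n) :
  0 <= \sum_(i < n) x ord0 i ^+ 2.
Proof. by apply: sumr_ge0 => i _; exact: sqr_ge0. Qed.

Lemma enorm_sqr {R : realType} {n : nat} (x : 'rV[R]_n) :
  enorm x ^+ 2 = \sum_(i < n) x ord0 i ^+ 2.
Proof. by rewrite sqr_sqrtr// sumsq_ge0. Qed.

Lemma enorm0 {R : realType} {n : nat} : enorm (0 : 'rV[R]_n) = 0.
Proof.
rewrite /enorm big1 ?sqrtr0// => i _; by rewrite mxE expr0n.
Qed.

Lemma enorm_eq0 {R : realType} {n : nat} (x : 'rV[R]_n) : enorm x = 0 -> x = 0.
Proof.
move=> x0; have /eqP := enorm_sqr x; rewrite x0 expr0n/= eq_sym psumr_eq0; last first.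
  by move=> i _; exact: sqr_ge0.
move=> /allP xi0; apply/rowP => i; rewrite mxE.
have := xi0 i; rewrite mem_index_enum => /(_ isT)/=.
by rewrite sqrf_eq0 => /eqP.
Qed.

Lemma enormZ {R : realType} {n : nat} (c : R) (x : 'rV[R]_n) :
  enorm (c *: x) = `|c| * enorm x.
Proof.
rewrite /enorm -sqrtr_sqr -sqrtrM ?sqr_ge0// mulr_sumr.
by congr Num.sqrt; apply: eq_bigr => i _; rewrite mxE exprMn.
Qed.

Lemma enormN {R : realType} {n : nat} (x : 'rV[R]_n) : enorm (- x) = enorm x.
Proof. by rewrite -scaleN1r enormZ normrN1 mul1r. Qed.

Lemma enormBC {R : realType} {n : nat} (x y : 'rV[R]_n) :
  enorm (x - y) = enorm (y - x).
Proof. by rewrite -enormN opprB. Qed.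

(** Cauchy-Schwarz, by summing the weighted arithmetic-geometric mean
inequalities [2 x_i y_i <= (b / a) x_i ^ 2 + (a / b) y_i ^ 2], where [a] and
[b] are the two norms. *)
Lemma dot_le_enorm {R : realType} {n : nat} (x y : 'rV[R]_n) :
  \sum_(i < n) x ord0 i * y ord0 i <= enorm x * enorm y.
Proof.
have [/enorm_eq0 ->|x0] := eqVneq (enorm x) 0.
  by rewrite enorm0 mul0r big1// => i _; rewrite mxE mul0r.
have [/enorm_eq0 ->|y0] := eqVneq (enorm y) 0.
  by rewrite enorm0 mulr0 big1// => i _; rewrite mxE mulr0.
have a0 : 0 < enorm x by rewrite lt_def x0 enorm_ge0.
have b0 : 0 < enorm y by rewrite lt_def y0 enorm_ge0.
move: (enorm_sqr x) (enorm_sqr y) a0 b0 {x0 y0}.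
set a := enorm x; set b := enorm y => aE bE a0 b0.
have -> : a * b = 2^-1 * (b / a) * a ^+ 2 + 2^-1 * (a / b) * b ^+ 2.
  by field; rewrite ?gt_eqF.
rewrite aE bE !mulr_sumr -big_split/=; apply: ler_sum => i _.
set p := x _ _; set q := y _ _.
suff : 0 <= 2^-1 * (a * b)^-1 * (b * p - a * q) ^+ 2.
  move=> h; rewrite -subr_ge0; apply: le_trans h _; rewrite le_eqVlt.
  by apply/orP; left; apply/eqP; field; rewrite ?gt_eqF.
by rewrite mulr_ge0 ?sqr_ge0// mulr_ge0 ?invr_ge0// mulr_ge0// ltW.
Qed.

Lemma enormD {R : realType} {n : nat} (x y : 'rV[R]_n) :
  enorm (x + y) <= enorm x + enorm y.
Proof.
rewrite -(@ler_pXn2r _ 2)// ?nnegrE ?addr_ge0 ?enorm_ge0//.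
rewrite sqrrD !enorm_sqr -mulr_natl.
have := dot_le_enorm x y; set d := \sum_i _ => dle.
have -> : \sum_(i < n) (x + y) ord0 i ^+ 2 =
    \sum_(i < n) x ord0 i ^+ 2 + 2 * d + \sum_(i < n) y ord0 i ^+ 2.
  rewrite mulr_sumr -!big_split/=; apply: eq_bigr => i _; rewrite mxE.
  by ring.
lra.
Qed.

Lemma enorm_dist_triangle {R : realType} {n : nat} (x y z : 'rV[R]_n) :
  enorm (x - z) <= enorm (x - y) + enorm (y - z).
Proof. by rewrite -[x - z](subrKA y) enormD. Qed.

Lemma enorm_continuous {R : realType} {n : nat} :
  continuous (@enorm R n).
Proof.
have sumC : continuous (fun x : 'rV[R]_n => \sum_(i < n) x ord0 i ^+ 2).
  apply: continuous_big; first exact: add_continuous.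
  move=> i _ y.
  apply: (continuous_comp (f := fun x : 'rV[R]_n => x ord0 i) (g := fun t : R => t ^+ 2)).
    exact: coord_continuous.
  exact: exprn_continuous.
move=> x; apply: (continuous_comp (sumC x)); exact: sqrt_continuous.
Qed.

Lemma enorm_dist_continuous {R : realType} {n : nat} (p : 'rV[R]_n) :
  continuous (fun x : 'rV[R]_n => enorm (x - p)).
Proof.
have subC : continuous (fun x : 'rV[R]_n => x - p).
  by move=> x; apply: continuousB; [exact: cvg_id | exact: cst_continuous].
by move=> x; apply: (continuous_comp (subC x)); exact: enorm_continuous.
Qed.

Lemma enorm_delta {R : realType} {n : nat} (i : 'I_n) :
  enorm (delta_mx ord0 i : 'rV[R]_n) = 1.
Proof.
rewrite /enorm (bigD1 i)//= mxE !eqxx expr1n big1 ?addr0 ?sqrtr1// => j ji.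
by rewrite mxE (negbTE ji) andbF expr0n.
Qed.

Lemma unit_direction {R : realType} {n : nat} (x : 'rV[R]_n) : (0 < n)%N ->
  exists2 e : 'rV[R]_n, enorm e = 1 & x = enorm x *: e.
Proof.
move=> n0; have [x0|x0] := eqVneq (enorm x) 0.
  exists (delta_mx ord0 (Ordinal n0)); first exact: enorm_delta.
  by rewrite x0 scale0r (enorm_eq0 _ x0).
exists ((enorm x)^-1 *: x); last by rewrite scalerA divff// scale1r.
by rewrite enormZ ger0_norm ?invr_ge0 ?enorm_ge0// mulVf.
Qed.

Lemma open_eball {R : realType} {n : nat} (a : 'rV[R]_n) (s : R) :
  open (eball a s).
Proof.
have -> : eball a s = (fun x : 'rV[R]_n => enorm (x - a)) @^-1` [set t | t < s] by [].
by apply: open_comp => [x _|]; [exact: enorm_dist_continuous | exact: open_lt].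
Qed.

Lemma closed_cball {R : realType} {n : nat} (a : 'rV[R]_n) (s : R) :
  closed [set x | enorm (x - a) <= s].
Proof.
have -> : [set x | enorm (x - a) <= s] =
  (fun x : 'rV[R]_n => enorm (x - a)) @^-1` [set t | t <= s] by [].
by apply: closed_comp => [x _|]; [exact: enorm_dist_continuous | exact: closed_le].
Qed.

(** Coordinates are bounded by [enorm], hence so is the sup norm. *)
Lemma norm_le_enorm {R : realType} {n : nat} (x : 'rV[R]_n) : `|x| <= enorm x.
Proof.
rewrite [leLHS]/Num.norm/= mx_normrE; apply/bigmax_leP; split.
  exact: enorm_ge0.
move=> [i j] _ /=; rewrite ord1 -sqrtr_sqr ler_sqrt ?sumsq_ge0//.
by rewrite (bigD1 j)//= lerDl; apply: sumr_ge0 => k _; exact: sqr_ge0.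
Qed.

Lemma compact_cball {R : realType} {n : nat} (a : 'rV[R]_n) (s : R) :
  compact [set x | enorm (x - a) <= s].
Proof.
apply: bounded_closed_compact; last exact: closed_cball.
exists (s + enorm a); split; first exact: num_real.
move=> M sM x /= xs; apply: le_trans (norm_le_enorm x) _.
have := enorm_dist_triangle x a 0; rewrite !subr0; lra.
Qed.

(** * Radial test functions *)

(** Directional derivatives are derivatives along lines, which makes the
one-variable chain rule available. *)
Lemma is_derive_line {R : realType} {V : normedModType R} (f : V -> R)
    (x v : V) (df : R) :
  is_derive x v f df <-> is_derive (0 : R) 1 (fun h : R => f (h *: v + x)) df.
Proof.
have E : 'D_v f x = 'D_1 (fun h : R => f (h *: v + x)) 0.
  rewrite /derive; set g1 := fun h => h^-1 *: _; set g2 := fun h => h^-1 *: _.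
  suff -> : g1 = g2 by [].
  by rewrite funeqE /g1 /g2 => h /=; rewrite addr0 scale0r add0r [_%:A]mulr1.
split=> -[d <-]; split; rewrite ?E//.
- exact: (proj1 (derivable1P _ _ _) d).
- exact: (proj2 (derivable1P _ _ _) d).
Qed.

Lemma is_derive_comp_line {R : realType} {V : normedModType R} (f : V -> R)
    (g : R -> R) (x v : V) (df dg : R) :
  is_derive x v f df -> is_derive (f x) 1 g dg -> is_derive x v (g \o f) (dg * df).
Proof.
move=> /is_derive_line fd gd; apply/is_derive_line.
have gd' : is_derive (f (0 *: v + x)) 1 g dg by rewrite scale0r add0r.
exact: (@is_derive1_comp _ g (fun h : R => f (h *: v + x)) 0 dg df gd' fd).
Qed.

Lemma is_derive_coord {R : realType} {n : nat} (p x v : 'rV[R]_n) (i : 'I_n) :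
  is_derive x v (fun y : 'rV[R]_n => y ord0 i - p ord0 i) (v ord0 i).
Proof.
apply/is_derive_line.
have -> : (fun h : R => (h *: v + x) ord0 i - p ord0 i) =
    (fun h => v ord0 i * h + (x ord0 i - p ord0 i)).
  by apply/funext => h; rewrite !mxE; ring.
apply: is_derive_eq; rewrite addr0; exact: mulr1.
Qed.

Lemma is_derive_sqdist {R : realType} {n : nat} (p x v : 'rV[R]_n) :
  is_derive x v (fun y : 'rV[R]_n => enorm (y - p) ^+ 2)
    (\sum_(i < n) 2 * (x ord0 i - p ord0 i) * v ord0 i).
Proof.
have -> : (fun y : 'rV[R]_n => enorm (y - p) ^+ 2) =
    \sum_(i < n) (fun y : 'rV[R]_n => y ord0 i - p ord0 i) ^+ 2.
  apply/funext => y; rewrite enorm_sqr fct_sumE; apply: eq_bigr => i _.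
  by rewrite !mxE exprfctE.
apply: is_derive_sum => i.
have /= := @is_deriveX _ _ (fun y : 'rV[R]_n => y ord0 i - p ord0 i) 2 x v _
  (is_derive_coord p x v i).
by rewrite expr1.
Qed.

Lemma is_derive_dist {R : realType} {n : nat} (p x : 'rV[R]_n) (j : 'I_n) :
  0 < enorm (x - p) ->
  is_derive x (delta_mx ord0 j) (fun y : 'rV[R]_n => enorm (y - p))
    ((x ord0 j - p ord0 j) / enorm (x - p)).
Proof.
move=> x0.
have -> : (fun y : 'rV[R]_n => enorm (y - p)) =
    Num.sqrt \o (fun y : 'rV[R]_n => enorm (y - p) ^+ 2).
  by apply/funext => y /=; rewrite sqrtr_sqr ger0_norm ?enorm_ge0.
have -> : (x ord0 j - p ord0 j) / enorm (x - p) =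
    (2 * Num.sqrt (enorm (x - p) ^+ 2))^-1 *
    \sum_(i < n) 2 * (x ord0 i - p ord0 i) * (delta_mx ord0 j : 'rV[R]_n) ord0 i.
  rewrite (bigD1 j)//= big1 ?addr0; last first.
    by move=> i ij; rewrite mxE (negbTE ij) andbF mulr0.
  by rewrite sqrtr_sqr gtr0_norm// mxE !eqxx/=; field; rewrite gt_eqF.
apply: is_derive_comp_line; first exact: is_derive_sqdist.
by apply: is_derive1_sqrt; rewrite exprn_gt0.
Qed.

Lemma continuous_addr {R : realType} {n : nat} (f g : 'rV[R]_n -> R) x :
  {for x, continuous f} -> {for x, continuous g} ->
  {for x, continuous (fun y => f y + g y)}.
Proof. exact: continuousD. Qed.

Lemma continuous_subr {R : realType} {n : nat} (f g : 'rV[R]_n -> R) x :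
  {for x, continuous f} -> {for x, continuous g} ->
  {for x, continuous (fun y => f y - g y)}.
Proof. exact: continuousB. Qed.

Lemma continuous_mulr {R : realType} {n : nat} (f g : 'rV[R]_n -> R) x :
  {for x, continuous f} -> {for x, continuous g} ->
  {for x, continuous (fun y => f y * g y)}.
Proof. exact: continuousM. Qed.

(** A cone is infinity-harmonic away from its vertex; a small quadratic term
makes it strictly sub- or superharmonic where its gradient does not vanish,
which is what viscosity comparison needs. The paraboloids [B = 0] serve for the minimum principle. *)
Definition bent_cone {R : realType} {n : nat} (p : 'rV[R]_n) (A B C : R)
    (x : 'rV[R]_n) : R :=
  A + B * enorm (x - p) + C * enorm (x - p) ^+ 2.

Lemma bent_cone_continuous {R : realType} {n : nat} (p : 'rV[R]_n) (A B C : R) :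
  continuous (bent_cone p A B C).
Proof.
move=> x; rewrite /bent_cone; have tC := enorm_dist_continuous p x.
apply: continuous_addr; first apply: continuous_addr; first exact: cst_continuous.
  by apply: continuous_mulr => //; exact: cst_continuous.
apply: continuous_mulr; first exact: cst_continuous.
exact: (continuous_mulr _ _ _ tC tC).
Qed.

Lemma is_derive_bent_cone {R : realType} {n : nat} (p : 'rV[R]_n) (A B C : R)
    (x : 'rV[R]_n) (i : 'I_n) : 0 < enorm (x - p) ->
  is_derive x (delta_mx ord0 i) (bent_cone p A B C)
    ((B / enorm (x - p) + 2 * C) * (x ord0 i - p ord0 i)).
Proof.
move=> x0.
have -> : (B / enorm (x - p) + 2 * C) * (x ord0 i - p ord0 i) =
  (B + C * (2 * enorm (x - p))) * ((x ord0 i - p ord0 i) / enorm (x - p)).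
  by field; rewrite gt_eqF.
apply: (is_derive_comp_line (fun y : 'rV[R]_n => enorm (y - p))
  (fun s => A + B * s + C * s ^+ 2)); first exact: is_derive_dist.
apply: is_derive_eq; rewrite /GRing.scale/= ?expr1; ring.
Qed.

Lemma is_derive_bent_cone_grad {R : realType} {n : nat} (p : 'rV[R]_n) (B C : R)
    (x : 'rV[R]_n) (i j : 'I_n) : 0 < enorm (x - p) ->
  is_derive x (delta_mx ord0 j)
    (fun y : 'rV[R]_n => (B / enorm (y - p) + 2 * C) * (y ord0 i - p ord0 i))
    ((B / enorm (x - p) + 2 * C) * (i == j)%:R -
     B / enorm (x - p) ^+ 3 * (x ord0 i - p ord0 i) * (x ord0 j - p ord0 j)).
Proof.
move=> x0.
have dF : is_derive x (delta_mx ord0 j)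
    ((fun s => B * s^-1 + 2 * C) \o (fun y : 'rV[R]_n => enorm (y - p)))
    (- B / enorm (x - p) ^+ 2 * ((x ord0 j - p ord0 j) / enorm (x - p))).
  apply: is_derive_comp_line; first exact: is_derive_dist.
  have dV : is_derive (enorm (x - p)) 1 (fun s : R => s^-1)
      (- enorm (x - p) ^- 2 *: 1).
    by apply: is_deriveV; rewrite gt_eqF.
  by apply: is_derive_eq; rewrite /GRing.scale/=; field; rewrite gt_eqF.
have dM := is_deriveM dF (is_derive_coord p x (delta_mx ord0 j) i).
apply: (is_derive_eq dM); rewrite /GRing.scale/= mxE eqxx/=.
by field; rewrite gt_eqF.
Qed.

Lemma near_dist_gt0 {R : realType} {n : nat} (p x : 'rV[R]_n) :
  0 < enorm (x - p) -> \forall y \near x, 0 < enorm (y - p).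
Proof.
move=> x0; have nb : nbhs (enorm (x - p)) [set t : R | 0 < t].
  by apply: open_nbhs_nbhs; split => //; exact: open_gt.
exact: (enorm_dist_continuous p x _ nb).
Qed.

Lemma near_eq_continuous {R : realType} {n : nat} (f g : 'rV[R]_n -> R)
    (x : 'rV[R]_n) :
  (\forall y \near x, g y = f y) -> {for x, continuous g} -> {for x, continuous f}.
Proof.
move=> gf gx; have gfx : g y @[y --> x] --> f x.
  by have <- : g x = f x := nbhs_singleton gf.
exact: (cvg_trans (@near_eq_cvg _ _ (nbhs x) _ g f gf) gfx).
Qed.

Lemma near_partial_bent_cone {R : realType} {n : nat} (p : 'rV[R]_n) (A B C : R)
    (x : 'rV[R]_n) (i : 'I_n) : 0 < enorm (x - p) ->
  \forall y \near x, (B / enorm (y - p) + 2 * C) * (y ord0 i - p ord0 i) =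
    partial i (bent_cone p A B C) y.
Proof.
move=> /near_dist_gt0; apply: filterS => y y0.
by have /@derive_val := is_derive_bent_cone p A B C y i y0.
Qed.

Lemma is_derive_partial_bent_cone {R : realType} {n : nat} (p : 'rV[R]_n)
    (A B C : R) (x : 'rV[R]_n) (i j : 'I_n) : 0 < enorm (x - p) ->
  is_derive x (delta_mx ord0 j) (partial i (bent_cone p A B C))
    ((B / enorm (x - p) + 2 * C) * (i == j)%:R -
     B / enorm (x - p) ^+ 3 * (x ord0 i - p ord0 i) * (x ord0 j - p ord0 j)).
Proof.
move=> x0; have := is_derive_bent_cone_grad p B C x i j x0.
exact/near_eq_is_derive/near_partial_bent_cone.
Qed.

Lemma continuous_coordB {R : realType} {n : nat} (p x : 'rV[R]_n) (i : 'I_n) :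
  {for x, continuous (fun y : 'rV[R]_n => y ord0 i - p ord0 i)}.
Proof.
by apply: continuous_subr; [exact: coord_continuous | exact: cst_continuous].
Qed.

Lemma bent_cone_C2 {R : realType} {n : nat} (p : 'rV[R]_n) (A B C : R)
    (x : 'rV[R]_n) : 0 < enorm (x - p) -> C2_near (bent_cone p A B C) x.
Proof.
move=> /near_dist_gt0; apply: filterS => y y0 i.
have tC := enorm_dist_continuous p y.
have VC k : {for y, continuous (fun z : 'rV[R]_n => B / enorm (z - p) ^+ k)}.
  apply: continuous_mulr; first exact: cst_continuous.
  apply: continuousV; first by rewrite expf_neq0// gt_eqF.
  exact: (continuous_comp (g := fun t : R => t ^+ k) tC (@exprn_continuous R k _)).
have KC : {for y, continuous (fun z : 'rV[R]_n => B / enorm (z - p) + 2 * C)}.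
  by apply: continuous_addr; [exact: (VC 1%N) | exact: cst_continuous].
split.
- by have [] := is_derive_bent_cone p A B C y i y0.
- apply: near_eq_continuous (near_partial_bent_cone p A B C y i y0) _.
  by apply: continuous_mulr => //; exact: continuous_coordB.
- move=> j; split; first by have [] := is_derive_partial_bent_cone p A B C y i j y0.
  have E : \forall z \near y,
      ((B / enorm (z - p) + 2 * C) * (i == j)%:R -
       B / enorm (z - p) ^+ 3 * (z ord0 i - p ord0 i) * (z ord0 j - p ord0 j)) =
      partial j (partial i (bent_cone p A B C)) z.
    apply: filterS (near_dist_gt0 p y y0) => z z0.
    by have /@derive_val := is_derive_partial_bent_cone p A B C z i j z0.
  apply: near_eq_continuous E _; apply: continuous_subr.
    by apply: continuous_mulr => //; exact: cst_continuous.
  apply: continuous_mulr; last exact: continuous_coordB.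
  by apply: continuous_mulr; [exact: VC | exact: continuous_coordB].
Qed.

Lemma grad_bent_cone {R : realType} {n : nat} (p : 'rV[R]_n) (A B C : R)
    (x : 'rV[R]_n) : 0 < enorm (x - p) ->
  grad (bent_cone p A B C) x = (B / enorm (x - p) + 2 * C) *: (x - p).
Proof.
move=> x0; apply/rowP => i; rewrite !mxE.
by have /@derive_val := is_derive_bent_cone p A B C x i x0.
Qed.

Lemma enorm_grad_bent_cone {R : realType} {n : nat} (p : 'rV[R]_n) (A B C : R)
    (x : 'rV[R]_n) : 0 < enorm (x - p) ->
  enorm (grad (bent_cone p A B C) x) = `|B + 2 * C * enorm (x - p)|.
Proof.
move=> x0; rewrite grad_bent_cone// enormZ -[X in _ * X](gtr0_norm x0) -normrM.
by congr `|_|; field; rewrite gt_eqF.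
Qed.

(** For a function [h] of the distance to [p] the infinity-Laplacian is
[h' ^ 2 * h''], so that its sign is that of the quadratic coefficient. *)
Lemma infty_laplacian_bent_cone {R : realType} {n : nat} (p : 'rV[R]_n)
    (A B C : R) (x : 'rV[R]_n) : 0 < enorm (x - p) ->
  infty_laplacian (bent_cone p A B C) x =
  2 * C * (B + 2 * C * enorm (x - p)) ^+ 2.
Proof.
move=> x0; rewrite /infty_laplacian grad_bent_cone//.
set t := enorm (x - p) in x0 *; set K := B / t + 2 * C.
have yE : t ^+ 2 = \sum_(i < n) (x ord0 i - p ord0 i) ^+ 2.
  by rewrite enorm_sqr; apply: eq_bigr => i _; rewrite !mxE.
have row j : ((K *: (x - p)) *m hess (bent_cone p A B C) x) ord0 j =
    K * (K - B / t ^+ 3 * t ^+ 2) * (x ord0 j - p ord0 j).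
  rewrite mxE.
  under eq_bigr => i _.
    rewrite !mxE (_ : partial i (partial j (bent_cone p A B C)) x =
     K * (j == i)%:R - B / t ^+ 3 * (x ord0 j - p ord0 j) * (x ord0 i - p ord0 i));
    last by have /@derive_val := is_derive_partial_bent_cone p A B C x j i x0.
    rewrite mulrBr (_ : K * _ * (K * _) =
      K * K * ((x ord0 i - p ord0 i) * (j == i)%:R)); last by ring.
    rewrite (_ : K * _ * (B / _ * _ * _) =
      K * (B / t ^+ 3) * (x ord0 j - p ord0 j) * (x ord0 i - p ord0 i) ^+ 2);
      last by ring.
    over.
  rewrite sumrB -!mulr_sumr -yE (bigD1 j)//= eqxx big1 ?addr0; last first.
    by move=> i ij; rewrite eq_sym (negbTE ij) mulr0.
  by rewrite /=; ring.
rewrite mxE; under eq_bigr => j _.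
  rewrite row !mxE (_ : _ * (K * _) =
    K * K * (K - B / t ^+ 3 * t ^+ 2) * (x ord0 j - p ord0 j) ^+ 2); last by ring.
  over.
by rewrite -mulr_sumr -yE /K; field; rewrite gt_eqF.
Qed.

(** * Comparison with bent cones *)

Lemma exists_min_diff {R : realType} {n : nat} (K : set 'rV[R]_n)
    (u f : 'rV[R]_n -> R) :
  compact K -> K !=set0 -> {within K, continuous u} -> continuous f ->
  exists2 z, K z & forall y, K y -> u z - f z <= u y - f y.
Proof.
move=> cK K0 uC fC.
have [z /set_mem Kz zmin] : exists2 z, z \in K &
    forall y, y \in K -> u z - f z <= u y - f y.
  apply: (@EVT_min_rV R n (fun y => u y - f y) K K0 cK) => y.
  by apply: continuousB; [exact: uC | exact: (continuous_subspaceT fC)].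
by exists z => // y Ky; apply: zmin; exact: mem_set.
Qed.

(** At an interior minimum of [u - phi] the function [phi] touches [u] from
below, and a supersolution is infinity-superharmonic there; but [phi] is
strictly infinity-subharmonic for [C > 0]. *)
Lemma supersolution_ge_bent_cone {R : realType} {n : nat}
    (Omega K : set 'rV[R]_n) (Lambda : R) (u : 'rV[R]_n -> R)
    (p : 'rV[R]_n) (A B C : R) :
  viscosity_supersolution Omega Lambda u ->
  compact K -> {within K, continuous u} -> 0 < C ->
  (forall z, K z -> bent_cone p A B C z <= u z \/
     [/\ Omega z, nbhs z K, 0 < enorm (z - p) &
         B + 2 * C * enorm (z - p) != 0]) ->
  forall z, K z -> bent_cone p A B C z <= u z.
Proof.
move=> super cK uC C0 bdry y Ky.
have [z Kz zmin] := exists_min_diff K u _ cK (ex_intro _ y Ky) uC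
  (bent_cone_continuous p A B C).
suff : bent_cone p A B C z <= u z by have := zmin _ Ky; lra.
have [//|[Oz zK z0 B0]] := bdry z Kz.
have zn : \forall w \near z,
    u z - bent_cone p A B C z <= u w - bent_cone p A B C w.
  exact: filterS zmin zK.
have := super z _ Oz (bent_cone_C2 p A B C z z0) zn.
rewrite /ground_state_op le_min => /andP[+ _].
rewrite infty_laplacian_bent_cone// oppr_ge0 pmulr_rle0 ?mulr_gt0//.
by rewrite leNgt exprn_even_gt0// B0.
Qed.

(** At an interior maximum of [u - phi] the subsolution property leaves two
alternatives; the first is excluded by strict infinity-superharmonicity of
[phi] for [C < 0], the second by a slope exceeding [Lambda * u]. *)
Lemma subsolution_le_bent_cone {R : realType} {n : nat}
    (Omega K : set 'rV[R]_n) (Lambda : R) (u : 'rV[R]_n -> R)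
    (p : 'rV[R]_n) (A B C : R) :
  viscosity_subsolution Omega Lambda u ->
  compact K -> {within K, continuous u} -> C < 0 ->
  (forall z, K z -> u z <= bent_cone p A B C z \/
     [/\ Omega z, nbhs z K, 0 < enorm (z - p),
         B + 2 * C * enorm (z - p) != 0 &
         Lambda * u z < `|B + 2 * C * enorm (z - p)|]) ->
  forall z, K z -> u z <= bent_cone p A B C z.
Proof.
move=> sub cK uC C0 bdry y Ky.
have NuC : {within K, continuous (- u)} by move=> z; apply: continuousN; exact: uC.
have NfC : continuous (- bent_cone p A B C).
  by move=> z; apply: continuousN; exact: bent_cone_continuous.
have [z Kz zmin] := exists_min_diff K _ _ cK (ex_intro _ y Ky) NuC NfC.
have zmax w : K w -> u w - bent_cone p A B C w <= u z - bent_cone p A B C z.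
  by move=> /zmin; rewrite !fctE; lra.
suff : u z <= bent_cone p A B C z by have := zmax _ Ky; lra.
have [//|[Oz zK z0 B0 Lu]] := bdry z Kz.
have zn : \forall w \near z,
    u w - bent_cone p A B C w <= u z - bent_cone p A B C z.
  exact: filterS zmax zK.
have := sub z _ Oz (bent_cone_C2 p A B C z z0) zn.
rewrite /ground_state_op ge_min enorm_grad_bent_cone// subr_le0 [X in _ || X]leNgt Lu orbF.
rewrite infty_laplacian_bent_cone// oppr_le0 pmulr_lge0 ?exprn_even_gt0// => h; lra.
Qed.

(** * Nonempty open sets have positive measure *)

Lemma lebesgue_segment {R : realType} (l h : R) :
  lebesgue_measure (`[l, h]%classic : set R) = (Num.max 0 (h - l))%:E.
Proof.
rewrite lebesgue_measure_itv/= lte_fin; case: ltP => lh.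
  by rewrite max_r// subr_ge0 ltW.
by rewrite max_l// subr_le0.
Qed.

Lemma integral_weighted_segment {R : realType} (a b l h c : R) : 0 <= c ->
  (\int[lebesgue_measure]_(t in `[a, b]) (c * \1_(`[l, h]%classic) t)%:E <=
   (c * Num.max 0 (h - l))%:E)%E.
Proof.
move=> c0; under eq_integral do rewrite EFinM.
rewrite ge0_integralZl_EFin//; last first.
  by apply/measurable_EFinP; exact: measurable_indic.
rewrite integral_indic// EFinM lee_wpmul2l ?lee_fin//.
rewrite -lebesgue_segment; apply: le_measure => //; rewrite ?inE//.
exact: measurableI.
Qed.

(** Induction on the dimension: the hypothesis for a fixed last coordinate [t]
is the same statement in one dimension less, with the weight of the [k]-th box
multiplied by the indicator of its last side at [t]; its conclusion is then
integrated over [t]. The statement for weight [1] alone would not be inductive. *)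
Lemma weighted_box_cover {R : realType} (n : nat) (a b : nat -> R)
    (l h : nat -> nat -> R) (w : nat -> R) :
  (forall k, 0 <= w k) -> (forall i, a i <= b i) ->
  (forall x : nat -> R, (forall i, a i <= x i <= b i) ->
     (1 <= \sum_(0 <= k <oo)
       (w k * \prod_(i < n) \1_(`[l k i, h k i]%classic) (x i))%:E)%E) ->
  ((\prod_(i < n) (b i - a i))%:E <= \sum_(0 <= k <oo)
       (w k * \prod_(i < n) Num.max 0 (h k i - l k i))%:E)%E.
Proof.
move=> + ab; elim: n w => [|n ih] w w0 cover.
  have aab i : a i <= a i <= b i by rewrite lexx ab.
  rewrite big_ord0; apply: le_trans (cover a aab) _.
  by apply: lee_nneseries => [k _ _|k _]; rewrite !big_ord0 ?lexx// lee_fin mulr1.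
pose V k := \prod_(i < n) Num.max 0 (h k i - l k i).
have V0 k : 0 <= V k by apply: prodr_ge0 => i _; rewrite le_max lexx.
have P0 : 0 <= \prod_(i < n) (b i - a i) by apply: prodr_ge0 => i _; rewrite subr_ge0.
have slice t : `[a n, b n]%classic t ->
    ((\prod_(i < n) (b i - a i))%:E <= \sum_(0 <= k <oo)
       (w k * V k * \1_(`[l k n, h k n]%classic) t)%:E)%E.
  rewrite /= in_itv/= => abt.
  rewrite (eq_eseriesr (g := fun k =>
    (w k * \1_(`[l k n, h k n]%classic) t * V k)%:E)); last first.
    by move=> k _; rewrite mulrAC.
  apply: ih => [k|x abx]; first by rewrite mulr_ge0.
  have := cover (fun i => if i == n then t else x i).
  move=> /(_ _)/le_trans; apply.
    by move=> i; case: eqP => [->|_].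
  rewrite le_eqVlt; apply/orP; left; apply/eqP/eq_eseriesr => k _.
  rewrite big_ord_recr/= eqxx; congr _%:E; rewrite mulrA mulrAC.
  by congr (_ * _ * _); apply: eq_bigr => i _; rewrite ltn_eqF.
have mI k : measurable_fun (`[a n, b n]%classic : set R)
    (fun t : R => w k * V k * \1_(`[l k n, h k n]%classic) t).
  by apply: measurable_funM => //; exact: measurable_indic.
rewrite big_ord_recr/= EFinM.
have -> : (b n - a n)%:E = lebesgue_measure (`[a n, b n]%classic : set R).
  by rewrite lebesgue_segment max_r// subr_ge0.
rewrite -integral_cst//.
apply: (@le_trans _ _ (\int[lebesgue_measure]_(t in `[a n, b n])
   \sum_(0 <= k <oo) (w k * V k * \1_(`[l k n, h k n]%classic) t)%:E)%E).
  apply: ge0_le_integral => //.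
  apply: ge0_emeasurable_sum => [k t _ _|k _]; last by apply/measurable_EFinP; exact: mI.
  by rewrite lee_fin !mulr_ge0.
rewrite integral_nneseries//; last 2 first.
- by move=> k; apply/measurable_EFinP; exact: mI.
- by move=> k t _; rewrite lee_fin !mulr_ge0.
apply: lee_nneseries => [k _ _|k _].
  by apply: integral_ge0 => t _; rewrite lee_fin !mulr_ge0.
rewrite big_ord_recr/= mulrA; apply: integral_weighted_segment.
exact: mulr_ge0.
Qed.

Lemma box_volume_ge0 {R : realType} {n : nat} (a b : 'rV[R]_n) :
  0 <= box_volume a b.
Proof. by apply: prodr_ge0 => i _; rewrite le_max lexx. Qed.

Lemma lebesgue_n_ge_box {R : realType} {n : nat} (a b : 'rV[R]_n)
    (A : set 'rV[R]_n) : (forall i, a ord0 i <= b ord0 i) -> box a b `<=` A ->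
  ((\prod_(i < n) (b ord0 i - a ord0 i))%:E <= lebesgue_n A)%E.
Proof.
move=> ab bA; apply: le_ereal_inf_tmp => _ [c /= cA <-].
(* Coordinates extended by [0] to all indices, where sides have length [0]. *)
pose ext (v : 'rV[R]_n) i := oapp (v ord0) 0 (insub i : option 'I_n).
have extE v (i : 'I_n) : ext v i = v ord0 i by rewrite /ext valK.
have -> : \prod_(i < n) (b ord0 i - a ord0 i) = \prod_(i < n) (ext b i - ext a i).
  by apply: eq_bigr => i _; rewrite !extE.
have -> : (\sum_(0 <= k <oo) (box_volume (c k).1 (c k).2)%:E = \sum_(0 <= k <oo)
    (1 * \prod_(i < n) Num.max 0 (ext (c k).2 i - ext (c k).1 i))%:E)%E.
  apply: eq_eseriesr => k _; rewrite mul1r; congr _%:E.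
  by apply: eq_bigr => i _; rewrite !extE.
apply: (weighted_box_cover n (ext a) (ext b) (fun k => ext (c k).1)
  (fun k => ext (c k).2) (fun=> 1)) => [//|i|x abx].
  by rewrite /ext; case: insub => //= j.
have [k _ kx] : (\bigcup_k box (c k).1 (c k).2) (\row_(i < n) x i).
  by apply/cA/bA => i; rewrite mxE -!extE.
apply: le_trans (nneseries_lim_ge k.+1 _); last first.
  by move=> j _ _; rewrite lee_fin mul1r; apply: prodr_ge0.
rewrite big_nat_recr//= -[leLHS]add0e leeD//.
  by apply: sume_ge0 => j _; rewrite lee_fin mul1r; apply: prodr_ge0.
rewrite lee_fin mul1r big1// => i _; rewrite indicE mem_set//=.
by have := kx i; rewrite mxE -!extE in_itv.
Qed.

Lemma lebesgue_n_open_neq0 {R : realType} {n : nat} (V : set 'rV[R]_n)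
    (x : 'rV[R]_n) : open V -> V x -> lebesgue_n V != 0%E.
Proof.
move=> oV Vx; have /nbhs_ballP[e /= e0 xeV] : nbhs x V by exact: open_nbhs_nbhs.
pose d := const_mx (e / 2) : 'rV[R]_n.
have bV : box (x - d) (x + d) `<=` V.
  move=> y /= xy; apply: xeV; split => // i j; rewrite ord1.
  have := xy j; rewrite !mxE => /andP[y1 y2].
  by rewrite /ball/= ltr_norml; lra.
rewrite gt_eqF//; apply: lt_le_trans (lebesgue_n_ge_box _ _ _ _ bV).
  by rewrite lte_fin; apply: prodr_gt0 => i _; rewrite !mxE; lra.
by move=> i; rewrite !mxE; lra.
Qed.

Lemma lebesgue_n_set0 {R : realType} {n : nat} : (0 < n)%N ->
  lebesgue_n (set0 : set 'rV[R]_n) = 0%E.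
Proof.
move=> n0; apply/eqP; rewrite eq_le; apply/andP; split; last first.
  apply: le_ereal_inf_tmp => _ [c _ <-]; apply: nneseries_ge0 => k _ _.
  by rewrite lee_fin box_volume_ge0.
apply: ereal_inf_lbound; exists (fun=> (0, 0)) => //=.
apply: eseries0 => k _ _; rewrite /box_volume (bigD1 (Ordinal n0))//= !mxE.
by rewrite subrr maxxx mul0r.
Qed.

(** * The eigenvalues of a ball *)

Lemma boundary_open {R : realType} {n : nat} (Omega : set 'rV[R]_n) :
  open Omega -> boundary Omega = closure Omega `\` Omega.
Proof. by move=> /interior_id oO; rewrite /boundary [X in _ `\` X]oO. Qed.

Lemma closure_open_cases {R : realType} {n : nat} (Omega : set 'rV[R]_n) x :
  open Omega -> closure Omega x -> Omega x \/ boundary Omega x.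
Proof.
move=> oO cx; rewrite boundary_open//.
by have [Ox|nOx] := pselect (Omega x); [left | right].
Qed.

Lemma closure_sub_cball {R : realType} {n : nat} (Omega : set 'rV[R]_n) a s :
  (forall x, Omega x -> enorm (x - a) <= s) ->
  forall x, closure Omega x -> enorm (x - a) <= s.
Proof.
move=> Os x /(closureS Os); rewrite -(proj1 (closure_id _))//.
exact: closed_cball.
Qed.

Lemma segment_continuous {R : realType} {n : nat} (x v : 'rV[R]_n) :
  continuous (fun t : R => x + t *: v).
Proof.
move=> t; apply: (@continuousD _ _ _ (cst x) (fun t : R => t *: v)).
  exact: cst_continuous.
exact: scalel_continuous.
Qed.

Lemma closure_eball {R : realType} {n : nat} (a : 'rV[R]_n) (s : R) : 0 < s ->
  closure (eball a s) = [set x | enorm (x - a) <= s].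
Proof.
move=> s0; apply/seteqP; split=> [|x /= xs].
  by apply: closure_sub_cball => x; exact: ltW.
move=> B /=; rewrite -[x](subrK a) addrC -[x - a]scale1r => nB.
have [e /= e0 eB] : \forall t \near (1 : R), B (a + t *: (x - a)).
  exact: (segment_continuous a (x - a) _ _ nB).
pose t := 1 - Num.min 1 e / 2.
have [t0 t1 te] : [/\ 0 <= t, t < 1 & 1 - t < e].
  by rewrite /t; case: (leP 1 e) => ?; split; lra.
exists (a + t *: (x - a)); split.
  rewrite /eball/= addrAC subrr add0r enormZ ger0_norm//.
  have := enorm_ge0 (x - a) => d0; nra.
by apply: eB; rewrite /ball/= gtr0_norm; lra.
Qed.

Lemma boundary_eball {R : realType} {n : nat} (a : 'rV[R]_n) (s : R) : 0 < s ->
  boundary (eball a s) = [set x | enorm (x - a) = s].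
Proof.
move=> s0; rewrite boundary_open; last exact: open_eball.
rewrite closure_eball//; apply/seteqP; split=> x /=; rewrite /eball/=.
  by move=> [xs /negP]; rewrite -leNgt => sx; apply/le_anti; rewrite xs.
by move=> ->; rewrite lexx ltxx.
Qed.

Lemma dist_set_le {R : realType} {n : nat} (x y : 'rV[R]_n)
    (A : set 'rV[R]_n) : A y -> dist_set x A <= enorm (x - y).
Proof.
move=> Ay; apply: ge_inf; last by exists y.
by exists 0 => _ [z _ <-]; exact: enorm_ge0.
Qed.

Lemma inradius_eball {R : realType} {n : nat} (r : R) : (0 < n)%N -> 0 < r ->
  inradius (eball (0 : 'rV[R]_n) r) = r.
Proof.
move=> n0 r0; rewrite /inradius boundary_eball//.
set S := [set x | _].
have up x : eball (0 : 'rV[R]_n) r x -> dist_set x S <= r.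
  rewrite /eball/= subr0 => xr; have [e e1 xE] := unit_direction x n0.
  have Sy : S (r *: e) by rewrite /S/= subr0 enormZ e1 mulr1 gtr0_norm.
  apply: le_trans (dist_set_le _ _ _ Sy) _.
  rewrite {1}xE -scalerBl enormZ e1 mulr1 ler0_norm; last by rewrite subr_le0 ltW.
  by have := enorm_ge0 x; lra.
have c0 : eball (0 : 'rV[R]_n) r 0 by rewrite /eball/= subrr enorm0.
apply/le_anti/andP; split.
  apply: ge_sup; first by exists (dist_set 0 S), 0.
  by move=> _ [x xr <-]; exact: up.
apply: (@le_trans _ _ (dist_set 0 S)).
  have [e e1 _] := unit_direction (0 : 'rV[R]_n) n0.
  apply: lb_le_inf.
    exists (enorm (0 - r *: e)), (r *: e) => //.
    by rewrite /S/= subr0 enormZ e1 mulr1 gtr0_norm.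
  by move=> _ [y /= Sy <-]; rewrite enormBC Sy.
apply: ub_le_sup; last by exists 0.
by exists r => _ [x xr <-]; exact: up.
Qed.

Lemma polygonal_length_segment {R : realType} {n : nat} (x v : 'rV[R]_n)
    (s : seq R) : itv_partition 0 1 s ->
  polygonal_length (fun t => x + t *: v) s = enorm v.
Proof.
move=> s01; have id_nd : {in `[0, 1]%R &, {homo (@id R) : a b / a <= b}} by [].
have := nondecreasing_variation id_nd s01; rewrite subr0 /variation/= => vE.
rewrite /polygonal_length/= -[RHS]mulr1 -[X in _ * X]vE mulr_sumr.
apply: eq_bigr => k _; rewrite mulrC -enormZ; congr enorm.
by rewrite opprD addrACA subrr add0r scalerBl.
Qed.

Lemma lipschitz_segment {R : realType} {n : nat} (x v : 'rV[R]_n) :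
  let g := fun t : R => x + t *: v in [lipschitz g t | t in `[0, 1]].
Proof.
move=> g.
apply: (@klipschitzW _ _ _ `|v|).
  by apply: (@globally_properfilter _ _ (0, 0)); split; rewrite /= in_itv/= lexx ler01.
move=> [s t] _ /=; rewrite opprD addrACA subrr add0r -scalerBl normrZ.
by rewrite mulrC.
Qed.

(** The open ball has convex closure, so segments realize its intrinsic
distance. *)
Lemma geodesic_dist_eball_le {R : realType} {n : nat} (r : R)
    (x y : 'rV[R]_n) : 0 < r -> enorm x <= r -> enorm y <= r ->
  (geodesic_dist (eball (0 : 'rV[R]_n) r) x y <= (enorm (y - x))%:E)%E.
Proof.
move=> r0 xr yr; apply: (@le_trans _ _ (curve_length (fun t : R => x + t *: (y - x)))).
  apply: ereal_inf_lbound; exists (fun t : R => x + t *: (y - x)) => //; split.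
  - exact: lipschitz_segment.
  - by rewrite scale0r addr0.
  - by rewrite scale1r addrC subrK.
  - move=> t /andP[t0 t1]; rewrite closure_eball//= subr0.
    have -> : x + t *: (y - x) = (1 - t) *: x + t *: y.
      by rewrite scalerBr scalerBl scale1r addrCA addrC.
    apply: le_trans (enormD _ _) _.
    rewrite !enormZ !ger0_norm ?subr_ge0//.
    have -> : r = (1 - t) * r + t * r by ring.
    by rewrite lerD// ler_wpM2l// subr_ge0.
apply: ge_ereal_sup => _ [s s01 <-].
by rewrite polygonal_length_segment.
Qed.

(** A curve is at least as long as the partition with the single step [0, 1]
says. *)
Lemma enorm_le_intrinsic_diam {R : realType} {n : nat} (Omega : set 'rV[R]_n)
    (x y : 'rV[R]_n) : closure Omega x -> closure Omega y ->
  ((enorm (x - y))%:E <= intrinsic_diam Omega)%E.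
Proof.
move=> cx cy; apply: (@le_trans _ _ (geodesic_dist Omega x y)); last first.
  by apply: ereal_sup_ubound; exists (x, y).
apply: le_ereal_inf_tmp => _ [g [_ g0 g1 _] <-].
apply: ereal_sup_ubound; exists [:: 1].
  exact: itv_partition1.
by rewrite /polygonal_length/= big_nat1/= g0 g1 enormBC.
Qed.

Lemma intrinsic_diam_eball {R : realType} {n : nat} (r : R) :
  (0 < n)%N -> 0 < r -> intrinsic_diam (eball (0 : 'rV[R]_n) r) = (2 * r)%:E.
Proof.
move=> n0 r0; apply/eqP; rewrite eq_le; apply/andP; split.
  apply: ge_ereal_sup => _ [[x y] [/= + +] <-].
  rewrite closure_eball//= !subr0 => xr yr.
  apply: le_trans (geodesic_dist_eball_le r x y r0 xr yr) _.
  by rewrite lee_fin; have := enormD y (- x); rewrite enormN; lra.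
have [e e1 _] := unit_direction (0 : 'rV[R]_n) n0.
have -> : 2 * r = enorm (r *: e - (- r) *: e).
  by rewrite -scalerBl enormZ e1 mulr1 gtr0_norm; lra.
by apply: enorm_le_intrinsic_diam; rewrite closure_eball//= subr0 enormZ e1
  mulr1 ?normrN gtr0_norm.
Qed.

Lemma lambdaD_eball {R : realType} {n : nat} (r : R) : (0 < n)%N -> 0 < r ->
  lambdaD (eball (0 : 'rV[R]_n) r) = r^-1.
Proof. by move=> n0 r0; rewrite /lambdaD inradius_eball. Qed.

Lemma lambdaN_eball {R : realType} {n : nat} (r : R) : (0 < n)%N -> 0 < r ->
  lambdaN (eball (0 : 'rV[R]_n) r) = r^-1.
Proof.
move=> n0 r0; rewrite /lambdaN intrinsic_diam_eball//=.
by field; rewrite gt_eqF.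
Qed.

(** * Domains with almost extremal inradius and intrinsic diameter *)

(** A segment from [a] cannot leave [Omega] without meeting its boundary. *)
Lemma eball_sub_domain {R : realType} {n : nat} (Omega : set 'rV[R]_n)
    (a : 'rV[R]_n) : open Omega -> Omega a ->
  eball a (dist_set a (boundary Omega)) `<=` Omega.
Proof.
move=> oO Oa z az; pose g (t : R) := a + t *: (z - a).
have gC : connected (g @` `[0, 1]).
  apply: connected_continuous_connected; first exact: segment_connected.
  exact/continuous_subspaceT/segment_continuous.
have gO : (g @` `[0, 1]) `&` Omega = (g @` `[0, 1]) `&` closure Omega.
  apply/seteqP; split=> [y [gy Oy]|y [[t t01 <-] cy]].
    by split => //; exact: subset_closure.
  split; first by exists t.
  have [//|bt] := closure_open_cases _ _ oO cy.
  have := dist_set_le a _ _ bt; rewrite enormBC /g addrAC subrr add0r enormZ.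
  move: t01 az; rewrite /eball/= in_itv/= => /andP[t0 t1] az; rewrite ger0_norm//.
  have := enorm_ge0 (z - a); nra.
have ga : (g @` `[0, 1]) a.
  by exists 0; rewrite /g ?scale0r ?addr0//= in_itv/= lexx ler01.
have gz : (g @` `[0, 1]) z.
  by exists 1; rewrite /g ?scale1r ?[a + _]addrC ?subrK//= in_itv/= lexx ler01.
have : (g @` `[0, 1]) `&` Omega = g @` `[0, 1].
  apply: gC; first by exists a.
  - by exists Omega.
  - by exists (closure Omega) => //; exact: closed_closure.
by move=> gE; move: gz; rewrite -gE => -[].
Qed.

(** A point of the closure at distance [t] from [a] and the antipodal points of
the inscribed ball are at distance almost [t + inradius]. *)
Lemma domain_sub_cball {R : realType} {n : nat} (Omega : set 'rV[R]_n)
    (a : 'rV[R]_n) (R1 D : R) : (0 < n)%N -> 0 < R1 ->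
  eball a R1 `<=` Omega -> (intrinsic_diam Omega <= D%:E)%E ->
  forall y, closure Omega y -> enorm (y - a) <= D - R1.
Proof.
move=> n0 R10 aO OD y cy; apply/ler_addgt0Pr => h h0.
have [e e1 yE] := unit_direction (y - a) n0.
(* The inscribed ball is open, hence a radius slightly below [R1]. *)
pose s := Num.max 0 (R1 - h).
have [s0 sR sh] : [/\ 0 <= s, s < R1 & R1 - h <= s].
  by rewrite /s; case: (leP 0 (R1 - h)) => ?; split; lra.
pose z := a - s *: e.
have Oz : Omega z.
  apply: aO; rewrite /eball/= /z addrAC subrr add0r enormN enormZ e1 mulr1.
  by rewrite ger0_norm.
have := le_trans (enorm_le_intrinsic_diam Omega y z cy (subset_closure Oz)) OD.
have -> : y - z = (y - a) + s *: e by rewrite /z opprB addrCA addrC.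
have := enorm_ge0 (y - a); set t := enorm (y - a) in yE * => t0.
rewrite yE lee_fin -scalerDl enormZ e1 mulr1 ger0_norm ?addr_ge0//.
by lra.
Qed.

Lemma eball_sub_cball_radius {R : realType} {n : nat} (a : 'rV[R]_n) (s rho : R) :
  (0 < n)%N -> 0 < s -> (forall y, eball a s y -> enorm (y - a) <= rho) ->
  s <= rho.
Proof.
move=> n0 s0 srho; have [e e1 _] := unit_direction (0 : 'rV[R]_n) n0.
apply/ler_addgt0Pr => h h0; pose t := Num.max 0 (s - h).
have [t0 ts th] : [/\ 0 <= t, t < s & s - h <= t].
  by rewrite /t; case: (leP 0 (s - h)) => ?; split; lra.
have aE : enorm (a + t *: e - a) = t.
  by rewrite addrAC subrr add0r enormZ e1 mulr1 ger0_norm.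
have := srho (a + t *: e); rewrite /eball/= aE => /(_ ts); lra.
Qed.

(** * Normalized ground states *)

Lemma nbhs_open_subset {R : realType} {n : nat} (A B : set 'rV[R]_n) x :
  open A -> A x -> A `<=` B -> nbhs x B.
Proof. by move=> oA Ax AB; apply: (filterS AB); exact: open_nbhs_nbhs. Qed.

Lemma compact_closure_domain {R : realType} {n : nat} (Omega : set 'rV[R]_n)
    (a : 'rV[R]_n) (rho : R) :
  (forall y, closure Omega y -> enorm (y - a) <= rho) -> compact (closure Omega).
Proof.
move=> Orho; apply: subclosed_compact (compact_cball a rho) Orho.
exact: closed_closure.
Qed.

(** Otherwise [|u| > M] on a null set containing [x] for some [M < |u x|]; this
set is open by continuity. *)
Lemma Linfty_norm1_le {R : realType} {n : nat} (Omega : set 'rV[R]_n)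
    (u : 'rV[R]_n -> R) (x : 'rV[R]_n) :
  open Omega -> {within closure Omega, continuous u} ->
  Linfty_norm Omega u = 1%E -> Omega x -> `|u x| <= 1.
Proof.
move=> oO uC u1 Ox; rewrite leNgt; apply/negP => ux.
have : (Linfty_norm Omega u < `|u x|%:E)%E by rewrite u1 lte_fin.
move=> /ereal_inf_lt[_ [M [M0 /eqP V0] <-]]; rewrite lte_fin => Mux.
move: V0; apply/negP; apply: (lebesgue_n_open_neq0 _ x); last by split; [exact: Ox | exact: Mux].
have uO : {in Omega, continuous u}.
  rewrite -continuous_open_subspace//.
  exact: continuous_subspaceW (@subset_closure _ _) uC.
rewrite openE => y [Oy My]; apply: filterI; first exact: open_nbhs_nbhs.
have nM : nbhs (u y) [set t : R | M < `|t|].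
  apply: open_nbhs_nbhs; split=> //.
  have -> : [set t : R | M < `|t|] = Num.norm @^-1` [set s : R | M < s] by [].
  by apply: open_comp => [t _|]; [exact: norm_continuous | exact: open_gt].
exact: (uO y (mem_set Oy) _ nM).
Qed.

(** The maximum of [u] is admissible in the essential supremum, so it is at least
[1]; in particular it is not attained on the boundary. *)
Lemma exists_peak {R : realType} {n : nat} (Omega : set 'rV[R]_n)
    (u : 'rV[R]_n -> R) (x : 'rV[R]_n) :
  (0 < n)%N -> open Omega -> compact (closure Omega) -> Omega x ->
  {within closure Omega, continuous u} ->
  (forall y, boundary Omega y -> u y = 0) ->
  (forall y, closure Omega y -> 0 <= u y) -> Linfty_norm Omega u = 1%E ->
  exists2 z, Omega z & u z = 1.
Proof.
move=> n0 oO cO Ox uC u0 upos u1.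
have NuC : {within closure Omega, continuous (- u)}.
  by move=> z; apply: continuousN; exact: uC.
have [z cz zmax] := exists_min_diff _ _ (cst 0) cO
  (ex_intro _ x (subset_closure Ox)) NuC (@cst_continuous _ _ _).
have uz : 1 <= u z.
  rewrite -lee_fin -[leLHS]u1; apply: ereal_inf_lbound; exists (u z) => //; split.
    exact: upos.
  rewrite (_ : [set _ | _] = set0) ?lebesgue_n_set0//.
  apply/seteqP; split=> // y [Oy]; have cy := subset_closure Oy.
  rewrite ger0_norm ?upos// ltNge => /negP; apply.
  by have := zmax y cy; rewrite !fctE !subr0 lerN2.
have [Oz|bz] := closure_open_cases _ _ oO cz; last first.
  by move: uz; rewrite u0// ler10.
exists z => //; apply/le_anti; rewrite uz andbT.
exact: le_trans (ler_norm _) (Linfty_norm1_le _ _ _ oO uC u1 Oz).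
Qed.

(** Minimum principle, by comparison with small multiples of
[|x - p| ^ 2 - T ^ 2], where [p] lies outside [Omega]. *)
Lemma supersolution_ge0 {R : realType} {n : nat} (Omega : set 'rV[R]_n)
    (Lambda : R) (u : 'rV[R]_n -> R) (a : 'rV[R]_n) (rho : R) :
  (0 < n)%N -> open Omega -> (forall y, closure Omega y -> enorm (y - a) <= rho) ->
  {within closure Omega, continuous u} ->
  viscosity_supersolution Omega Lambda u ->
  (forall y, boundary Omega y -> u y = 0) ->
  forall y, closure Omega y -> 0 <= u y.
Proof.
move=> n0 oO Orho uC super u0 y cy; rewrite -subr_le0 add0r.
have rho0 : 0 <= rho := le_trans (enorm_ge0 _) (Orho y cy).
have [e e1 _] := unit_direction (0 : 'rV[R]_n) n0.
(* [p] is at distance at least [1] from [closure Omega], so that paraboloids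
   about [p] have nonzero gradient on it. *)
pose p := a + (rho + 1) *: e; pose T := 2 * rho + 1.
have pa : enorm (p - a) = rho + 1.
  by rewrite /p addrAC subrr add0r enormZ e1 mulr1 gtr0_norm//; lra.
have tT z : closure Omega z -> 1 <= enorm (z - p) <= T.
  move=> /Orho za; have := enorm_dist_triangle z a p.
  have := enorm_dist_triangle p z a; rewrite pa (enormBC a p) pa (enormBC p z) /T.
  by move=> ? ?; apply/andP; split; lra.
apply/ler_addgt0Pr => h h0; rewrite add0r.
have T0 : 0 < T by rewrite /T; lra.
pose g := h / T ^+ 2.
have gE : g * T ^+ 2 = h by rewrite /g mulfVK// expf_neq0// gt_eqF.
have g0 : 0 < g by rewrite divr_gt0// exprn_gt0.
suff : bent_cone p (- h) 0 g y <= u y.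
  rewrite /bent_cone mul0r addr0.
  by have := mulr_ge0 (ltW g0) (sqr_ge0 (enorm (y - p))); lra.
apply: (supersolution_ge_bent_cone Omega (closure Omega) Lambda) => //.
  exact: compact_closure_domain Orho.
move=> z cz; have /andP[t1 t2] := tT z cz.
have [Oz|bz] := closure_open_cases _ _ oO cz; last first.
  left; rewrite u0// /bent_cone mul0r addr0 -gE.
  have : enorm (z - p) ^+ 2 <= T ^+ 2 by rewrite ler_pXn2r// nnegrE; lra.
  by move=> /(ler_wpM2l (ltW g0)); lra.
right; have t0 : 0 < enorm (z - p) by lra.
split => //; last by rewrite add0r gt_eqF// mulr_gt0// mulr_gt0.
exact: nbhs_open_subset oO Oz (@subset_closure _ Omega).
Qed.

(** The cone vanishing on the sphere of radius [rho] about [a] lies above [u]: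
at the vertex because [u <= 1], elsewhere by comparison, its slope being at
least [Lambda * u]. *)
Lemma subsolution_le_cone {R : realType} {n : nat} (Omega : set 'rV[R]_n)
    (Lambda : R) (u : 'rV[R]_n -> R) (a : 'rV[R]_n) (rho : R) :
  open Omega -> (forall y, closure Omega y -> enorm (y - a) <= rho) ->
  {within closure Omega, continuous u} ->
  viscosity_subsolution Omega Lambda u ->
  (forall y, boundary Omega y -> u y = 0) ->
  (forall y, Omega y -> u y <= 1) -> 0 <= Lambda -> 1 <= Lambda * rho ->
  forall y, closure Omega y -> u y <= Lambda * (rho - enorm (y - a)).
Proof.
move=> oO Orho uC sub u0 u1 L0 Lrho y cy; apply/ler_addgt0Pr => h h0.
have rho0 : 0 <= rho := le_trans (enorm_ge0 _) (Orho y cy).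
have M0 : 0 < rho + rho ^+ 2 + 1 by have := sqr_ge0 rho; lra.
pose g := h / (rho + rho ^+ 2 + 1).
have gE : g * (rho + rho ^+ 2 + 1) = h by rewrite /g mulfVK// gt_eqF.
have g0 : 0 < g by rewrite divr_gt0.
pose A := (Lambda + g) * rho + g * rho ^+ 2.
have bcE z : bent_cone a A (- (Lambda + g)) (- g) z =
    (Lambda + g) * (rho - enorm (z - a)) + g * (rho ^+ 2 - enorm (z - a) ^+ 2).
  by rewrite /bent_cone /A; ring.
suff : u y <= bent_cone a A (- (Lambda + g)) (- g) y.
  rewrite bcE => /le_trans; apply; rewrite -subr_ge0 -gE.
  rewrite (_ : _ - _ = g * (1 + enorm (y - a) + enorm (y - a) ^+ 2)); last by ring.
  by rewrite mulr_ge0 ?(ltW g0)// !addr_ge0 ?enorm_ge0// sqr_ge0.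
apply: (subsolution_le_bent_cone Omega (closure Omega) Lambda) => //.
- exact: compact_closure_domain Orho.
- by rewrite oppr_lt0.
move=> z cz; have t1 := Orho z cz; have t0 := enorm_ge0 (z - a).
have sq : enorm (z - a) ^+ 2 <= rho ^+ 2 by rewrite ler_pXn2r.
have [Oz|bz] := closure_open_cases _ _ oO cz; last first.
  by left; rewrite u0// bcE addr_ge0// mulr_ge0 ?subr_ge0//; lra.
have [ta|ta] := eqVneq (enorm (z - a)) 0.
  left; rewrite bcE ta subr0 expr0n/= subr0; apply: le_trans (u1 z Oz) _.
  have := mulr_ge0 (ltW g0) rho0; have := mulr_ge0 (ltW g0) (sqr_ge0 rho).
  by rewrite mulrDl; lra.
have tp : 0 < enorm (z - a) by rewrite lt_def ta.
have gt : 0 < g * enorm (z - a) by rewrite mulr_gt0.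
have slope : - (Lambda + g) + 2 * - g * enorm (z - a) < - Lambda by lra.
right; split => //.
- exact: nbhs_open_subset oO Oz (@subset_closure _ Omega).
- by rewrite lt_eqF//; lra.
- rewrite ltr0_norm; last by lra.
  by have := ler_wpM2l L0 (u1 z Oz); lra.
Qed.

(** The cone with vertex at a point where [u = 1], vanishing on the sphere of a
ball inside [Omega], lies below [u]. *)
Lemma supersolution_ge_cone {R : realType} {n : nat} (Omega : set 'rV[R]_n)
    (Lambda : R) (u : 'rV[R]_n -> R) (z1 : 'rV[R]_n) (d : R) :
  open Omega -> compact (closure Omega) ->
  {within closure Omega, continuous u} ->
  viscosity_supersolution Omega Lambda u ->
  (forall y, closure Omega y -> 0 <= u y) ->
  u z1 = 1 -> 0 < d -> eball z1 d `<=` Omega ->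
  forall y, closure Omega y -> 1 - enorm (y - z1) / d <= u y.
Proof.
move=> oO cO uC super upos uz1 d0 dO y cy.
(* Beyond the sphere the cone is negative. *)
have [yd|yd] := ltP d (enorm (y - z1)).
  by apply: le_trans (upos y cy); rewrite subr_le0 ler_pdivlMr// mul1r ltW.
apply/ler_addgt0Pr => h h0.
pose c := Num.min h 2^-1.
have [c0 ch c2] : [/\ 0 < c, c <= h & c <= 2^-1].
  by rewrite /c; case: (leP h 2^-1) => ?; split; lra.
pose K := closure Omega `&` [set z | enorm (z - z1) <= d].
have bcE z : bent_cone z1 1 (- (1 + c) / d) (c / d ^+ 2) z =
    1 - (1 + c) * (enorm (z - z1) / d) + c * (enorm (z - z1) / d) ^+ 2.
  by rewrite /bent_cone; field; rewrite gt_eqF.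
suff : bent_cone z1 1 (- (1 + c) / d) (c / d ^+ 2) y <= u y.
  rewrite bcE; set s := enorm (y - z1) / d.
  have s0 : 0 <= s by rewrite divr_ge0 ?enorm_ge0// ltW.
  have s1 : s <= 1 by rewrite ler_pdivrMr// mul1r.
  have := ler_wpM2l (ltW c0) s1; have := mulr_ge0 (ltW c0) (sqr_ge0 s); lra.
apply: (supersolution_ge_bent_cone Omega K Lambda) => //.
- by apply: compact_closedI => //; exact: closed_cball.
- by apply: continuous_subspaceW uC => z [].
- by rewrite divr_gt0// exprn_gt0.
move=> z [cz /= zd].
have [z0|z0] := eqVneq (enorm (z - z1)) 0.
  left; rewrite bcE z0 mul0r expr0n/= !mulr0 subr0 addr0.
  have /eqP := enorm_eq0 _ z0.
  by rewrite subr_eq0 => /eqP ->; rewrite uz1.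
move: zd; rewrite le_eqVlt => /orP[/eqP zd|zd].
  left; rewrite bcE zd divff ?gt_eqF// expr1n !mulr1.
  by apply: le_trans (upos z cz); lra.
right; split.
- exact: dO.
- apply: (nbhs_open_subset _ _ _ (open_eball z1 d) zd) => w wd.
  by split; [exact/subset_closure/dO | exact: ltW].
- by rewrite lt_def z0 enorm_ge0.
- rewrite (_ : _ + _ = - (1 + c - 2 * c * (enorm (z - z1) / d)) / d); last first.
    by field; rewrite gt_eqF.
  rewrite mulf_neq0 ?invr_eq0 ?(gt_eqF d0)// oppr_eq0 gt_eqF//.
  have s1 : enorm (z - z1) / d < 1 by rewrite ltr_pdivrMr// mul1r.
  have := ltr_pM2l c0 (enorm (z - z1) / d) 1; rewrite s1; lra.
Qed.

(** * Stability *)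

(** The bound on [eta] confines [s] to [0 < s < 2 * r], where inversion is
Lipschitz. *)
Lemma inv_close {R : realType} (r eta s : R) : 0 < r -> 0 < eta ->
  eta <= r / 8 -> `|s^-1 - r^-1| < eta / (2 * r ^+ 2) ->
  0 < s /\ `|s - r| <= eta.
Proof.
move=> r0 e0 er; pose q := r^-1.
have rq : r * q = 1 by rewrite divff// gt_eqF.
have q0 : 0 < q by rewrite invr_gt0.
have -> : eta / (2 * r ^+ 2) = eta * q * q / 2 by rewrite /q; field; rewrite gt_eqF.
have eq8 : eta * q <= 1 / 8 by have := ler_wpM2r (ltW q0) er; lra.
rewrite -/q ltr_norml => /andP[h1 h2].
have eqq := ler_wpM2r (ltW q0) eq8.
have k0 : 0 < s^-1 by lra.
have s0 : 0 < s by rewrite -invr_gt0.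
have sk : s * s^-1 = 1 by rewrite divff// gt_eqF.
split=> //.
have sq : s * q <= 16 / 15.
  have : s * (15 / 16 * q) <= s * s^-1 by rewrite ler_wpM2l ?(ltW s0)//; lra.
  lra.
have eqs : eta * (s * q) <= eta * (16 / 15) by rewrite ler_wpM2l// ltW.
have sr : 0 < s * r by rewrite mulr_gt0.
have l1 := ltr_pM2l sr (- (eta * q * q / 2)) (s^-1 - q); rewrite h1 in l1.
have l2 := ltr_pM2l sr (s^-1 - q) (eta * q * q / 2); rewrite h2 in l2.
have E1 : s * r * (s^-1 - q) = r - s.
  by rewrite (_ : _ * _ = (s * s^-1) * r - s * (r * q)); [rewrite sk rq; ring | ring].
have E2 : s * r * (eta * q * q / 2) = eta * (s * q) / 2.
  by rewrite (_ : _ * _ = (r * q) * (eta * (s * q) / 2)); [rewrite rq; ring | ring].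
move: l1 l2; rewrite mulrN E1 E2 => l1 l2.
by rewrite ler_norml; lra.
Qed.

(** The upper cone exceeds [1 - t / r] by at most [4 * eta / R1]. *)
Lemma upper_estimate {R : realType} (r eps eta R1 D t U : R) :
  0 < r -> 0 < eta -> eta <= r / 8 -> eta <= eps * r / 15 ->
  `|R1 - r| <= eta -> D <= 2 * r + eta -> 0 <= t -> t < r ->
  U <= R1^-1 * (D - R1 - t) -> U - (1 - t / r) < eps.
Proof.
move=> r0 e0 er ee; rewrite ler_norml => /andP[R1l R1u] Du t0 tr UL.
have R10 : 0 < R1 by lra.
pose s := t / r.
have tE : t = s * r by rewrite /s mulfVK// gt_eqF.
have s0 : 0 <= s by rewrite divr_ge0// ltW.
have s1 : s <= 1 by rewrite ler_pdivrMr// mul1r ltW.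
have UR : R1 * U <= D - R1 - t.
  by have := ler_wpM2l (ltW R10) UL; rewrite mulrA divff ?mul1r// gt_eqF.
rewrite -/s -(ltr_pM2l R10) mulrBr.
have sR : s * (R1 - r) <= eta.
  apply: le_trans (_ : s * eta <= _); first by rewrite ler_wpM2l//; lra.
  by rewrite ler_piMl// ltW.
have : R1 * U - R1 * (1 - s) <= 4 * eta by lra.
have eps0 : 0 < eps * r by lra.
have ep : 0 < eps by rewrite -(pmulr_lgt0 _ r0).
have : eps * (7 / 8 * r) <= eps * R1 by rewrite ler_wpM2l ?(ltW ep)//; lra.
lra.
Qed.

(** The lower cone, with vertex at distance [t1] from the centre, falls short of
[1 - t / r] by at most [7 * eta / (R1 - t1)]. *)
Lemma lower_estimate {R : realType} (r eps eta R1 D t t1 tau U : R) :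
  0 < r -> 0 < eta -> eta <= r / 8 -> eta <= eps * r / 15 ->
  `|R1 - r| <= eta -> D <= 2 * r + eta -> 0 <= t -> t < r ->
  0 <= t1 -> t1 <= D - 2 * R1 -> tau <= t + t1 ->
  1 - tau / (R1 - t1) <= U -> 1 - t / r - U < eps.
Proof.
move=> r0 e0 er ee; rewrite ler_norml => /andP[R1l R1u] Du t0 tr t10 t1u taul UL.
set d := R1 - t1 in UL.
have d2 : r / 2 <= d by rewrite /d; lra.
have d0 : 0 < d by lra.
pose s := t / r.
have tE : t = s * r by rewrite /s mulfVK// gt_eqF.
have s0 : 0 <= s by rewrite divr_ge0// ltW.
have s1 : s <= 1 by rewrite ler_pdivrMr// mul1r ltW.
have dU : d - tau <= d * U.
  have := ler_wpM2l (ltW d0) UL.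
  by rewrite mulrBr mulr1 mulrCA divff ?mulr1// gt_eqF.
rewrite -/s -(ltr_pM2l d0) mulrBr.
have sd : s * (r - d) <= 4 * eta.
  apply: le_trans (_ : s * (4 * eta) <= _); first by rewrite ler_wpM2l// /d; lra.
  by rewrite ler_piMl//; lra.
have : d * (1 - s) - d * U <= 7 * eta by lra.
have eps0 : 0 < eps * r by lra.
have ep : 0 < eps by rewrite -(pmulr_lgt0 _ r0).
have : eps * (r / 2) <= eps * d by rewrite ler_wpM2l ?(ltW ep).
lra.
Qed.

Theorem theorem1p3 (R : realType) (n : nat) (r : R)
  (n_gt0 : (0 < n)%N) (r_gt0 : 0 < r) (eps : R) (eps_gt0 : 0 < eps) :
  exists delta1 delta2 : R, [/\ 0 < delta1, 0 < delta2 &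
    forall (Omega : set 'rV[R]_n) (u : 'rV[R]_n -> R),
      bounded_domain Omega ->
      lebesgue_n Omega = lebesgue_n (eball (0 : 'rV[R]_n) r) ->
      `|lambdaD Omega - lambdaD (eball (0 : 'rV[R]_n) r)| < delta1 ->
      `|lambdaN Omega - lambdaN (eball (0 : 'rV[R]_n) r)| < delta2 ->
      normalized_infty_ground_state Omega u ->
      forall a : 'rV[R]_n, incenter Omega a ->
      forall x : 'rV[R]_n, Omega (a + x) -> eball 0 r x ->
        `|u (a + x) - v_infty r x| < eps].
Proof.
(* The two cones differ from [v_infty] by less than [15 * eta / r] as soon as
   [R1] and [D] are within [eta] of [r] and [2 * r]; [eta <= r / 8] keeps the
   radius of the lower cone at least [r / 2]. *)
pose eta := Num.min (r / 8) (eps * r / 15).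
have er0 : 0 < eps * r by rewrite mulr_gt0.
have [eta0 eta8 etae] : [/\ 0 < eta, eta <= r / 8 & eta <= eps * r / 15].
  by rewrite /eta; case: (leP (r / 8) (eps * r / 15)) => ?; split; lra.
exists (eta / (2 * r ^+ 2)), (eta / 2 / (2 * r ^+ 2)); split.
- by rewrite divr_gt0// mulr_gt0// exprn_gt0.
- by rewrite !divr_gt0// mulr_gt0// exprn_gt0.
move=> Omega u [oO _ _] _.
rewrite lambdaD_eball// lambdaN_eball// {1}/lambdaD => hD hN.
move=> [[uC super sub u0 _] u1] a [Oa aR] x Oax; rewrite /eball/= subr0 => xr.
set R1 := inradius Omega in hD aR.
have [R10 R1r] := inv_close r eta R1 r_gt0 eta0 eta8 hD.
pose D := fine (intrinsic_diam Omega).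
have [D0 Dr] : 0 < D / 2 /\ `|D / 2 - r| <= eta / 2.
  have hD2 : `|(D / 2)^-1 - r^-1| < eta / 2 / (2 * r ^+ 2) by rewrite invf_div.
  by apply: (inv_close r (eta / 2)) => //; lra.
(* [D] is positive, so it does not come from an infinite diameter. *)
have DE : (intrinsic_diam Omega <= D%:E)%E.
  move: D0; rewrite /D; case: (intrinsic_diam Omega) => [s||] //=; last by rewrite leNye.
  by rewrite mul0r ltxx.
have aO : eball a R1 `<=` Omega by rewrite -aR; exact: eball_sub_domain.
have Orho := domain_sub_cball Omega a R1 D n_gt0 R10 aO DE.
have D2R : 2 * R1 <= D.
  have := eball_sub_cball_radius a R1 (D - R1) n_gt0 R10.
  by move=> /(_ (fun y ay => Orho y (subset_closure (aO y ay)))); lra.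
have cO := compact_closure_domain Omega a _ Orho.
have ule1 y : Omega y -> u y <= 1.
  by move=> Oy; exact: le_trans (ler_norm _) (Linfty_norm1_le _ _ _ oO uC u1 Oy).
have upos := supersolution_ge0 Omega _ u a _ n_gt0 oO Orho uC super u0.
have L0 : 0 <= lambdaD Omega by rewrite invr_ge0 ltW.
have Lrho : 1 <= lambdaD Omega * (D - R1).
  by rewrite /lambdaD -/R1 mulrC ler_pdivlMr// mul1r; lra.
have ucone := subsolution_le_cone Omega _ u a _ oO Orho uC sub u0 ule1 L0 Lrho.
have [z Oz uz] := exists_peak Omega u a n_gt0 oO cO Oa uC u0 upos u1.
have z1 : enorm (z - a) <= D - 2 * R1.
  have := ucone z (subset_closure Oz).
  by rewrite uz /lambdaD -/R1 mulrC ler_pdivlMr// mul1r; lra.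
have z0 := enorm_ge0 (z - a).
have [R1l R1u] : r - eta <= R1 /\ R1 <= r + eta.
  by move: R1r; rewrite ler_norml => /andP[? ?]; split; lra.
have Du : D <= 2 * r + eta by move: Dr; rewrite ler_norml => /andP[? ?]; lra.
have zO : eball z (R1 - enorm (z - a)) `<=` Omega.
  move=> y; rewrite /eball/= => yz; apply: aO; rewrite /eball/=.
  by have := enorm_dist_triangle y z a; lra.
have d0 : 0 < R1 - enorm (z - a) by lra.
have lcone := supersolution_ge_cone Omega _ u z _ oO cO uC super upos uz d0 zO.
have cax := subset_closure Oax.
have xa : enorm (a + x - a) = enorm x by rewrite addrAC subrr add0r.
rewrite /v_infty ltr_norml ltrNl opprB; apply/andP; split.
  apply: (lower_estimate r eps eta R1 D _ _ _ _ r_gt0 eta0 eta8 etae R1r Du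
    (enorm_ge0 x) xr z0 z1 _ (lcone _ cax)).
  by have := enorm_dist_triangle (a + x) a z; rewrite xa (enormBC a z).
apply: (upper_estimate r eps eta R1 D _ _ r_gt0 eta0 eta8 etae R1r Du
  (enorm_ge0 x) xr).
by have := ucone _ cax; rewrite xa.
Qed.
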